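(* Let $A\in\mathbb{C}^{n\times n}$ be nonsingular with a multisplitting $(M_k,N_k,E_k)_{k=1}^m$ satisfying one of the following conditions: (i) $E_k=\beta_k I$ and $M_k^*A+A^*N_k=M_k^*M_k-N_k^*N_k\succ 0$ for $k=1,2,\dots,m$; (ii) $E_k=\beta_k I$ and $\|M_k^{-1}N_k\|_2<1$ for $k=1,2,\dots,m$. Let $T=\sum_{k=1}^m E_kM_k^{-1}N_k$ and $\rho=\rho(T)$. Then, for every $b\in\mathbb{C}^n$, the relaxed multisplitting algorithm with relaxation parameter $\omega$ converges to the unique solution of $Ax=b$ for any choice of the initial guess $x^{(0)}\in\mathbb{C}^n$, provided $\omega\in(0,2/(1+\rho))$.
   Context: A multisplitting of $A\in\mathbb{C}^{n\times n}$ is a collection of triples of $n\times n$ matrices $(M_k,N_k,E_k)_{k=1}^m$ such that $A=M_k-N_k$ with $M_k$ nonsingular for $k=1,\dots,m$, and the $E_k$ are diagonal matrices with nonnegative entries satisfying $\sum_{k=1}^m E_k=I$. When $E_k=\beta_k I$, the $\beta_k$ are thus nonnegative scalars with $\sum_{k=1}^m\beta_k=1$. The relaxed multisplitting algorithm for $Ax=b$ with real parameter $\omega\neq0$: given $x^{(0)}$, for $i=0,1,2,\dots$ solve $M_k y_k=N_k x^{(i)}+b$ for $k=1,\dots,m$ and set $x^{(i+1)}=\omega\sum_{k=1}^m E_k y_k+(1-\omega)x^{(i)}$. Equivalently $x^{(i+1)}=T_\omega x^{(i)}+\omega\sum_{k=1}^mE_kM_k^{-1}b$ with $T_\omega=\omega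 T+(1-\omega)I$. $X^*$ denotes the conjugate transpose, $X\succ0$ means $X$ is Hermitian positive definite, $\|\cdot\|_2$ is the spectral norm, and $\rho(\cdot)$ is the spectral radius. *)

(* Defs.v *)
From HB Require Import structures.
From mathcomp Require Import all_boot all_order all_algebra.
From mathcomp Require Import all_classical all_reals all_analysis.
From mathcomp Require Import complex.

Set Implicit Arguments.
Unset Strict Implicit.
Unset Printing Implicit Defensive.

Import Order.TTheory GRing.Theory Num.Theory numFieldNormedType.Exports.

Local Open Scope classical_set_scope.
Local Open Scope ring_scope.
Local Open Scope complex_scope.
Local Open Scope sesquilinear_scope.

(* MathComp-Analysis attaches the modulus topology only to the sort of an
   abstract numFieldType; this makes it available on R[i] itself, and hence
   the (product) topology on matrices and vectors over R[i]. *)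
HB.instance Definition _ (R : realType) := NormedModule.copy R[i] R[i]^o.

Section Norms.
Variable R : realType.

Definition vnorm2 (n : nat) (x : 'cV[R[i]]_n) : R :=
  Num.sqrt (\sum_i Normc.normc (x i 0) ^+ 2).

(* The operator norm induced by the Euclidean norm; the closed unit ball is
   used rather than the unit sphere so that the set is nonempty when n = 0. *)
Definition spectral_norm (n : nat) (X : 'M[R[i]]_n) : R :=
  sup [set vnorm2 (X *m x) | x in [set x : 'cV[R[i]]_n | vnorm2 x <= 1]].

(* [eigenvalue] refers to row eigenvectors, which gives the same spectrum. *)
Definition spectral_radius (n : nat) (X : 'M[R[i]]_n) : R :=
  sup [set Normc.normc a | a in [set a : R[i] | eigenvalue X a]].

(* In the order of R[i], 0 < z means that z is real and positive. *)
Definition posdefmx (n : nat) (X : 'M[R[i]]_n) : Prop :=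
  X \is hermsymmx /\
  forall x : 'cV[R[i]]_n, x != 0 -> 0 < (x^t* *m X *m x) 0 0.

End Norms.

Section Multisplitting.
Variables (R : realType) (n m : nat).
Implicit Types (A : 'M[R[i]]_n) (M N E : 'I_m -> 'M[R[i]]_n).

Definition multisplitting A M N E : Prop :=
  [/\ forall k, A = M k - N k /\ M k \in unitmx,
      forall k, is_diag_mx (E k) /\ forall i j, 0 <= E k i j
    & \sum_k E k = 1%:M].

Definition relaxed_step M N E (omega : R) (b x : 'cV[R[i]]_n) : 'cV[R[i]]_n :=
  let y k := invmx (M k) *m (N k *m x + b) in
  omega%:C *: (\sum_k E k *m y k) + (1 - omega)%:C *: x.

Definition relaxed_multisplitting M N E (omega : R) (b x0 : 'cV[R[i]]_n)
    : nat -> 'cV[R[i]]_n :=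
  fun i => iter i (relaxed_step M N E omega b) x0.

End Multisplitting.

(* Main.v *)
(* In either case the matrices M_k^-1 N_k all strictly decrease one common norm:
   |x| in case (ii), and |A x| in case (i), because A M^-1 N = N M^-1 A. Since the
   weights are scalar and convex, so does T; hence every eigenvalue c of T has
   modulus < 1, and the eigenvalues w c + 1 - w of T_w have modulus at most
   w |c| + |1 - w| < 1 for 0 < w < 2 / (1 + rho). The norm of T_w itself may
   exceed 1, so convergence of the powers of T_w to 0 is obtained from its
   eigenvalues, by splitting the characteristic polynomial (Cayley-Hamilton). *)
Require Import Defs.
From HB Require Import structures.
From mathcomp Require Import all_boot all_order all_algebra.
From mathcomp Require Import all_classical all_reals all_analysis.
From mathcomp Require Import complex.
From mathcomp Require Import ring lra.

Set Implicit Arguments.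
Unset Strict Implicit.
Unset Printing Implicit Defensive.

Import Order.TTheory GRing.Theory Num.Theory numFieldNormedType.Exports.

Local Open Scope classical_set_scope.
Local Open Scope ring_scope.
Local Open Scope complex_scope.
Local Open Scope sesquilinear_scope.

Lemma normc_ge0 (R : rcfType) (z : R[i]) : 0 <= Normc.normc z.
Proof. by case: z => x y; exact: sqrtr_ge0. Qed.

Lemma normc_real (R : rcfType) (x : R) : Normc.normc x%:C = `|x|.
Proof. by rewrite /= expr0n addr0 sqrtr_sqr. Qed.

(** * Limits of scalar sequences and of complex vectors *)

Section Limits.
Variable R : realType.
Implicit Types (q : R) (r e : nat -> R).

Lemma cvg0_linear_recurrence q r e : 0 <= q < 1 ->
  (forall k, 0 <= r k) -> (forall k, r k.+1 <= q * r k + e k) ->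
  e @ \oo --> 0 -> r @ \oo --> 0.
Proof.
move=> /andP[q0 q1] r0 rS e0; apply/cvgrPdist_lt => eps eps0.
(* Chosen so that [eps / 2] is the fixed point of [t |-> q * t + d]: once [e] stays below [d], the
   excess of [r] over [eps / 2] shrinks geometrically. *)
set d := eps * (1 - q) / 2.
have d0 : 0 < d by rewrite /d divr_gt0// mulr_gt0// subr_gt0.
have /cvgrPdist_lt/(_ d d0) [K _ eK] := e0.
have rK j : r (K + j)%N <= q ^+ j * r K + eps / 2.
  elim: j => [|j IHj]; first by rewrite addn0 expr0; lra.
  rewrite addnS exprS; apply: (le_trans (rS _)).
  have := eK (K + j)%N (leq_addr _ _); rewrite /= sub0r normrN => /ltW/ler_normlW.
  have := ler_wpM2l q0 IHj.
  rewrite mulrDr -mulrA /d; nra.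
have /cvgrPdist_lt/(_ (eps / 2) ltac:(lra)) [L _ qL] : geometric (r K) q @ \oo --> 0.
  by apply: cvg_geometric; rewrite ger0_norm.
exists (K + L)%N => //= j jKL.
rewrite sub0r normrN ger0_norm//.
have jK : (K <= j)%N := leq_trans (leq_addr _ _) jKL.
rewrite -(subnKC jK); apply: (le_lt_trans (rK _)).
have := qL (j - K)%N; rewrite /= leq_subRL// => /(_ jKL).
rewrite sub0r normrN => /ltr_normlW; rewrite mulrC; lra.
Qed.

Lemma cvg_mx_normc n (u : nat -> 'cV[R[i]]_n) (l : 'cV[R[i]]_n) :
  (forall i, Normc.normc (u k i 0 - l i 0) @[k --> \oo] --> 0) ->
  u @ \oo --> l.
Proof.
move=> ul; apply/cvg_ballP => eps eps0.
(* Radii of balls lie in [R[i]]; positivity forces the imaginary part [d'] to vanish, leaving the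
   real radius [d]. *)
case: eps eps0 => d d' /= /[dup] eps0; rewrite ltcE /= => /andP[/eqP d'E d0].
have /= H : \forall k \near \oo, forall i, Normc.normc (u k i 0 - l i 0) < d.
  apply: filter_forall => i.
  have /cvgrPdist_lt/(_ d d0) := ul i.
  by apply: filterS => k; rewrite sub0r normrN; exact/le_lt_trans/ler_norm.
apply: filterS H => k H; split=> // i j.
rewrite -ball_normE /ball_ /= (ord1 j) distrC.
by rewrite ltcE /= d'E eqxx H.
Qed.

End Limits.

(** * Powers of a matrix with eigenvalues in the open unit disc *)

Section PowerConvergence.
Variables (R : realType) (n : nat).
Implicit Types (X : 'M[R[i]]_n.+1) (v : 'cV[R[i]]_n.+1).

(* Peeling off one factor of a split annihilating polynomial p: w = (X - a) v
   is annihilated by the other factors, and the orbit of v satisfies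
   X^(k+1) v = a X^k v + X^k w. *)
Lemma cvg0_iter_annihilator X (s : seq R[i]) v i :
  (forall a, a \in s -> Normc.normc a < 1) ->
  horner_mx X (\prod_(a <- s) ('X - a%:P)) *m v = 0 ->
  Normc.normc (iter k (mulmx X) v i 0) @[k --> \oo] --> 0.
Proof.
elim: s v => [|a s IHs] v s1.
  rewrite big_nil rmorph1 mul1mx => ->.
  rewrite (_ : (fun k => _) = cst 0); first exact: cvg_cst.
  apply/funext => k; suff -> : iter k (mulmx X) 0 = 0 :> 'cV_n.+1 by rewrite mxE Normc.normc0.
  by elim: k => [|k IHk]; rewrite ?mxE// iterS IHk mulmx0.
(* The factors are commuted so that [X - a] acts on [v] first. *)
rewrite big_cons mulrC rmorphM /= -mulmxE -mulmxA => /IHs cvw.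
have {}cvw := cvw (fun b bs => s1 b (mem_behead (s := a :: s) bs)).
have /s1 a1 : a \in a :: s by rewrite mem_head.
apply: (cvg0_linear_recurrence (q := Normc.normc a)) cvw.
- by rewrite normc_ge0 a1.
- by move=> k; exact: normc_ge0.
move=> k; rewrite -Normc.normcM.
have -> : iter k.+1 (mulmx X) v = a *: iter k (mulmx X) v
    + iter k (mulmx X) (horner_mx X ('X - a%:P) *m v); last first.
  by rewrite !mxE; exact: le_normcD.
elim: k => [|k IHk].
  rewrite rmorphB /= horner_mx_X horner_mx_C mulmxBl mul_scalar_mx.
  by rewrite addrC subrK.
by rewrite [LHS]iterS [in LHS]IHk mulmxDr -scalemxAr.
Qed.

End PowerConvergence.

Lemma cvg0_iter_eigenvalue_lt1 (R : realType) n (X : 'M[R[i]]_n) (v : 'cV_n) i :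
  (forall a, eigenvalue X a -> Normc.normc a < 1) ->
  Normc.normc (iter k (mulmx X) v i 0) @[k --> \oo] --> 0.
Proof.
case: n X v i => [|n] X v; first by case.
move=> i X1; have [s sE] := closed_field_poly_normal (char_poly X).
have {}sE : char_poly X = \prod_(z <- s) ('X - z%:P).
  by rewrite sE (monicP (char_poly_monic X)) scale1r.
apply: (@cvg0_iter_annihilator _ _ X s).
  by move=> a sa; apply: X1; rewrite eigenvalue_root_char sE root_prod_XsubC.
by rewrite -sE Cayley_Hamilton mul0mx.
Qed.

(** * Euclidean norm: convexity and the induced operator norm *)

Section SquaredNorm.
Variables (R : realType) (n : nat).
Implicit Types (x : 'cV[R[i]]_n) (X : 'M[R[i]]_n).

Definition sqnorm2 x : R := \sum_i Normc.normc (x i 0) ^+ 2.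

Lemma sqnorm2_ge0 x : 0 <= sqnorm2 x.
Proof. by apply: sumr_ge0 => i _; exact: sqr_ge0. Qed.

Lemma sqnorm2_eq0 x : (sqnorm2 x == 0) = (x == 0).
Proof.
apply/eqP/eqP => [/psumr_eq0P x0|->].
  apply/matrixP => i j; rewrite (ord1 j) mxE.
  apply: Normc.eq0_normc; apply/eqP; rewrite -sqrf_eq0; apply/eqP.
  by apply: x0 => // k _; exact: sqr_ge0.
by rewrite /sqnorm2 big1// => i _; rewrite mxE Normc.normc0 expr0n.
Qed.

Lemma sqnorm2_gt0 x : x != 0 -> 0 < sqnorm2 x.
Proof. by move=> x0; rewrite lt0r sqnorm2_eq0 x0 sqnorm2_ge0. Qed.

Lemma sqnorm2Z a x : sqnorm2 (a *: x) = Normc.normc a ^+ 2 * sqnorm2 x.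
Proof.
by rewrite /sqnorm2 mulr_sumr; apply: eq_bigr => i _; rewrite mxE Normc.normcM exprMn.
Qed.

Lemma vnorm2Z a x : vnorm2 (a *: x) = Normc.normc a * vnorm2 x.
Proof.
by rewrite /vnorm2 -!/(sqnorm2 _) sqnorm2Z sqrtrM ?sqr_ge0// sqrtr_sqr ger0_norm ?normc_ge0.
Qed.

Lemma adjmx_mul_sqnorm2 x : (x^t* *m x) 0 0 = (sqnorm2 x)%:C.
Proof.
rewrite mxE rmorph_sum /=; apply: eq_bigr => i _.
by rewrite !mxE mulrC -normCK /= rmorphXn.
Qed.

Lemma normc_sum (I : Type) (r : seq I) (F : I -> R[i]) :
  Normc.normc (\sum_(k <- r) F k) <= \sum_(k <- r) Normc.normc (F k).
Proof.
elim/big_ind2: _ => [|x x' y y' xx' yy'|//]; first by rewrite Normc.normc0.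
by apply: (le_trans (le_normcD _ _)); exact: lerD.
Qed.

(** The difference of the two sides is the variance of [r] under the weights [beta], with mean
    [c]. *)
Lemma sqr_convex_sum (I : finType) (beta r : I -> R) :
  (forall k, 0 <= beta k) -> \sum_k beta k = 1 ->
  (\sum_k beta k * r k) ^+ 2 <= \sum_k beta k * r k ^+ 2.
Proof.
move=> b0 b1; set c := \sum_k beta k * r k.
have : 0 <= \sum_k beta k * (r k - c) ^+ 2.
  by apply: sumr_ge0 => k _; rewrite mulr_ge0// sqr_ge0.
rewrite (eq_bigr (fun k => beta k * r k ^+ 2 - 2 * c * (beta k * r k)
   + c ^+ 2 * beta k)); last by move=> k _; ring.
rewrite big_split sumrB /= -!mulr_sumr b1 -/c; lra.
Qed.

Lemma sqnorm2_convex_sum (I : finType) (beta : I -> R) (y : I -> 'cV[R[i]]_n) :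
  (forall k, 0 <= beta k) -> \sum_k beta k = 1 ->
  sqnorm2 (\sum_k (beta k)%:C *: y k) <= \sum_k beta k * sqnorm2 (y k).
Proof.
move=> b0 b1.
under [leRHS]eq_bigr do rewrite mulr_sumr.
rewrite exchange_big /=; apply: ler_sum => i _.
apply: le_trans (sqr_convex_sum _ b0 b1).
rewrite ler_sqr ?nnegrE; last 2 first.
- exact: normc_ge0.
- by apply: sumr_ge0 => k _; rewrite mulr_ge0// normc_ge0.
rewrite summxE; apply: (le_trans (normc_sum _ _)).
apply: ler_sum => k _; by rewrite mxE Normc.normcM normc_real ger0_norm.
Qed.

Lemma sqnorm2_convex_lt (I : finType) (beta : I -> R) (y : I -> 'cV[R[i]]_n) (c : R) :
  (forall k, 0 <= beta k) -> \sum_k beta k = 1 ->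
  (forall k, sqnorm2 (y k) < c) ->
  sqnorm2 (\sum_k (beta k)%:C *: y k) < c.
Proof.
move=> b0 b1 yc; apply: (le_lt_trans (sqnorm2_convex_sum _ b0 b1)).
rewrite -[ltRHS]mul1r -b1 mulr_suml -subr_gt0 -sumrB.
have F0 k : 0 <= beta k * c - beta k * sqnorm2 (y k).
  by rewrite -mulrBr mulr_ge0// subr_ge0 ltW.
(* Some weights may vanish, but equality would make all of them vanish, although they sum to 1. *)
rewrite lt_neqAle sumr_ge0// andbT eq_sym; apply/negP => /eqP/psumr_eq0P E.
suff : \sum_k beta k = 0 by rewrite b1 => /eqP; rewrite oner_eq0.
apply: big1 => k _; apply/eqP; have /eqP := E (fun k _ => F0 k) k isT.
by rewrite -mulrBr mulf_eq0 => /orP[//|]; rewrite subr_eq0 gt_eqF.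
Qed.

(* The supremum defining [spectral_norm] is over a bounded set; without this,
   [sup] would return a junk value. *)
Lemma has_ubound_spectral_norm X :
  has_ubound [set vnorm2 (X *m x) | x in [set x | vnorm2 x <= 1]].
Proof.
(* Entries of a vector of the unit ball have modulus at most 1, so each entry of [X *m x] is bounded
   by an absolute row sum of [X]. *)
exists (Num.sqrt (\sum_i (\sum_j Normc.normc (X i j)) ^+ 2)) => _ [x /= x1 <-].
have xj j : Normc.normc (x j 0) <= 1.
  apply: le_trans x1; rewrite -[leLHS]ger0_norm ?normc_ge0// -sqrtr_sqr.
  apply: ler_wsqrtr; rewrite (bigD1 j)//= lerDl sumr_ge0// => k _; exact: sqr_ge0.
apply: ler_wsqrtr; apply: ler_sum => i _.
rewrite ler_sqr ?nnegrE ?normc_ge0 ?sumr_ge0// => [|j _]; last exact: normc_ge0.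
rewrite mxE; apply: (le_trans (normc_sum _ _)); apply: ler_sum => j _.
by rewrite Normc.normcM ler_piMr// normc_ge0.
Qed.

Lemma vnorm2_mulmx_le X x : vnorm2 (X *m x) <= spectral_norm X * vnorm2 x.
Proof.
have [->|x0] := eqVneq x 0.
  by rewrite mulmx0 -[0 : 'cV_n](scale0r 0) vnorm2Z Normc.normc0 !mul0r mulr0.
have vx : 0 < vnorm2 x by rewrite sqrtr_gt0 sqnorm2_gt0.
have c0 : 0 <= (vnorm2 x)^-1 by rewrite invr_ge0 ltW.
have cE : Normc.normc ((vnorm2 x)^-1)%:C = (vnorm2 x)^-1.
  by rewrite normc_real ger0_norm.
rewrite -ler_pdivrMr// mulrC -[X in X * _]cE -vnorm2Z scalemxAr.
apply: ub_le_sup; first exact: has_ubound_spectral_norm.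
by exists (((vnorm2 x)^-1)%:C *: x) => //=; rewrite vnorm2Z cE mulVf// gt_eqF.
Qed.

Lemma sqnorm2_mulmx_lt X x : spectral_norm X < 1 -> x != 0 ->
  sqnorm2 (X *m x) < sqnorm2 x.
Proof.
move=> X1 x0; have vx : 0 < vnorm2 x by rewrite sqrtr_gt0 sqnorm2_gt0.
have : vnorm2 (X *m x) < vnorm2 x.
  by apply: (le_lt_trans (vnorm2_mulmx_le _ _)); rewrite gtr_pMl.
by rewrite ltr_sqrt// sqnorm2_gt0.
Qed.

(** [X - a] and its transpose are singular together, and a row eigenvector of [X^T] is a transposed
    column eigenvector of [X]. *)
Lemma eigenvalue_cV X a : eigenvalue X a ->
  exists2 v : 'cV[R[i]]_n, X *m v = a *: v & v != 0.
Proof.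
rewrite /eigenvalue /eigenspace kermx_eq0 row_free_unit -unitmx_tr.
rewrite linearB /= tr_scalar_mx -row_free_unit -kermx_eq0.
move=> /(@eigenvalueP _ _ X^T a)[v vX v0]; exists v^T; last by rewrite trmx_eq0.
by apply: trmx_inj; rewrite trmx_mul trmxK vX linearZ /= trmxK.
Qed.

End SquaredNorm.

(** * Error propagation through one splitting and its relaxation *)

Lemma splitting_step (K : comUnitRingType) n (A M N : 'M[K]_n) (x z : 'cV[K]_n) :
  A = M - N -> M \in unitmx ->
  invmx M *m (N *m x + A *m z) = z + invmx M *m N *m (x - z).
Proof.
move=> -> uM.
(* The exact solution [z] is reproduced by the splitting; only the error [x - z] is transformed. *)
have -> : N *m x + (M - N) *m z = M *m z + N *m (x - z).
  by rewrite mulmxBl mulmxBr addrCA.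
by rewrite mulmxDr mulKmx// mulmxA.
Qed.

Lemma convex_combinationB (K : nzRingType) (V : lmodType K) (c : K) (x y z : V) :
  c *: (z + y) + (1 - c) *: x - z = c *: y + (1 - c) *: (x - z).
Proof.
rewrite scalerDr scalerBr [X in _ = _ + (_ - X)]scalerBl scale1r opprB !addrA.
by congr (_ - z); rewrite [RHS]addrC addrA.
Qed.

(** * Contraction and location of the eigenvalues *)

Section Contraction.
Variables (R : realType) (n : nat).
Implicit Types (A M N S : 'M[R[i]]_n).

Lemma sqnorm2_lt_posdefmx M N (x : 'cV[R[i]]_n) :
  posdefmx (M^t* *m M - N^t* *m N) -> x != 0 ->
  sqnorm2 (N *m x) < sqnorm2 (M *m x).
Proof.
move=> [_ /(_ x) MN] /MN.
have sqE (P : 'M[R[i]]_n) : x^t* *m (P^t* *m P) *m x = (P *m x)^t* *m (P *m x).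
  by rewrite trmx_mul map_mxM !mulmxA.
rewrite mulmxBr mulmxBl !sqE mxE [X in _ + X]mxE !adjmx_mul_sqnorm2.
by rewrite -rmorphB /= ltcR subr_gt0.
Qed.

(* Since A M^-1 N = N M^-1 A when A = M - N, the hypothesis says that
   M^-1 N contracts the norm x |-> ||A x||. *)
Lemma splitting_contraction A M N (v : 'cV[R[i]]_n) :
  A \in unitmx -> A = M - N -> M \in unitmx ->
  posdefmx (M^t* *m M - N^t* *m N) -> v != 0 ->
  sqnorm2 (A *m (invmx M *m N *m v)) < sqnorm2 (A *m v).
Proof.
move=> uA AE uM MN v0.
(* At this vector, [M] gives [A v] and [N] gives [A M^-1 N v]. *)
have x0 : invmx M *m (A *m v) != 0.
  by apply: contraNneq v0 => /(congr1 (mulmx (invmx A *m M)));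
    rewrite mulmx0 -mulmxA mulKVmx// mulKmx// => ->.
have := sqnorm2_lt_posdefmx MN x0; rewrite mulKVmx//.
suff -> : A *m (invmx M *m N *m v) = N *m (invmx M *m (A *m v)) by [].
rewrite !mulmxA; congr (_ *m v).
(* Both products equal [N - N M^-1 N]. *)
by rewrite AE mulmxBl mulmxBr mulmxV// mulmxBl mul1mx -!mulmxA mulVmx// mulmx1.
Qed.

Lemma eigenvalue_convex_contraction (I : finType) (beta : I -> R)
    (G : I -> 'M[R[i]]_n) S a :
  (forall k, 0 <= beta k) -> \sum_k beta k = 1 ->
  (forall k (v : 'cV_n), v != 0 -> sqnorm2 (S *m (G k *m v)) < sqnorm2 (S *m v)) ->
  eigenvalue (\sum_k (beta k)%:C *: G k) a -> Normc.normc a < 1.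
Proof.
move=> b0 b1 SG /eigenvalue_cV[v Gv v0].
have := sqnorm2_convex_lt b0 b1 (fun k => SG k v v0).
have -> : \sum_k (beta k)%:C *: (S *m (G k *m v)) = a *: (S *m v).
  rewrite scalemxAr -Gv mulmx_suml mulmx_sumr; apply: eq_bigr => k _.
  by rewrite -scalemxAl scalemxAr.
(* Strictness makes [S v] nonzero, so its squared norm can be cancelled. *)
move=> av; have Sv := le_lt_trans (sqnorm2_ge0 _) av.
move: av; rewrite sqnorm2Z gtr_pMl// -[X in _ < X](expr1n _ 2).
by rewrite ltr_sqr ?nnegrE ?normc_ge0.
Qed.

Lemma le_spectral_radius (X : 'M[R[i]]_n) a :
  has_ubound [set Normc.normc c | c in [set c | eigenvalue X c]] ->
  eigenvalue X a -> Normc.normc a <= spectral_radius X.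
Proof. by move=> Xb Xa; apply: ub_le_sup => //; exists a. Qed.

(* An eigenvalue of wT + (1 - w)I is w c + 1 - w for some eigenvalue c of T. *)
Lemma relaxed_eigenvalue_lt1 (T : 'M[R[i]]_n) (omega : R) a :
  (forall c, eigenvalue T c -> Normc.normc c < 1) ->
  0 < omega < 2 / (1 + spectral_radius T) ->
  eigenvalue (omega%:C *: T + ((1 - omega)%:C)%:M) a -> Normc.normc a < 1.
Proof.
move=> T1 /andP[w0 w2] /eigenvalueP[v vT v0].
have wC0 : omega%:C != 0 :> R[i] by rewrite fmorph_eq0 gt_eqF.
set c := (a - (1 - omega)%:C) / omega%:C.
have aE : a = omega%:C * c + (1 - omega)%:C by rewrite /c mulrCA divff// mulr1 subrK.
have Tc : eigenvalue T c.
  apply/eigenvalueP; exists v => //.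
  apply: (scalerI wC0); rewrite scalemxAr scalerA.
  move: vT; rewrite mulmxDr mul_mx_scalar aE scalerDl.
  exact: addIr.
have crho : Normc.normc c <= spectral_radius T.
  (* The bound 1 on the moduli makes the supremum defining the spectral radius genuine. *)
  by apply: le_spectral_radius => //; exists 1 => _ [d /T1/ltW d1 <-].
have c1 := T1 _ Tc; have c0 := normc_ge0 c.
rewrite aE; apply: (le_lt_trans (le_normcD _ _)).
rewrite Normc.normcM !normc_real (gtr0_norm w0).
have {}w2 : omega * (1 + spectral_radius T) < 2 by rewrite -ltr_pdivlMr//; lra.
(* For [omega <= 1], [|c| < 1] suffices; beyond 1, the bound is [omega * (1 + rho) - 1], and the
   upper limit on [omega] enters. *)
have [w1|w1] := leP omega 1.
  rewrite ger0_norm; last lra.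
  nra.
rewrite ltr0_norm; last lra.
nra.
Qed.

End Contraction.

Theorem theorem3p18 (R : realType) (n m : nat) (A : 'M[R[i]]_n)
    (M N E : 'I_m -> 'M[R[i]]_n) :
  A \in unitmx ->
  multisplitting A M N E ->
  (forall k, exists beta : R, E k = (beta%:C)%:M) /\
  (forall k, (M k)^t* *m A + A^t* *m N k
               = (M k)^t* *m M k - (N k)^t* *m N k
             /\ posdefmx ((M k)^t* *m M k - (N k)^t* *m N k))
  \/
  (forall k, exists beta : R, E k = (beta%:C)%:M) /\
  (forall k, spectral_norm (invmx (M k) *m N k) < 1) ->
  let T := \sum_k E k *m invmx (M k) *m N k in
  let rho := spectral_radius T in
  forall (b : 'cV[R[i]]_n) (omega : R), 0 < omega < 2 / (1 + rho) ->
  exists xs : 'cV[R[i]]_n,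
    unique (fun z => A *m z = b) xs /\
    forall x0 : 'cV[R[i]]_n,
      relaxed_multisplitting M N E omega b x0 @ \oo --> xs.
Proof.
move=> uA [AMN E0 E1] cases T rho b omega w2.
have xsE : A *m (invmx A *m b) = b by rewrite mulKVmx.
exists (invmx A *m b); split; first by split=> // z <-; rewrite mulKmx.
move: (invmx A *m b) xsE => xs xsE x0.
have stepE x : relaxed_step M N E omega b x - xs
    = (omega%:C *: T + ((1 - omega)%:C)%:M) *m (x - xs).
  have -> : relaxed_step M N E omega b x
      = omega%:C *: (xs + T *m (x - xs)) + (1 - omega)%:C *: x.
    congr (_ *: _ + _); rewrite -[X in X + _]mul1mx -E1 !mulmx_suml -big_split /=.
    apply: eq_bigr => k _; have [AE uM] := AMN k.
    by rewrite -xsE (splitting_step _ _ AE uM) mulmxDr !mulmxA.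
  rewrite mulmxDl mul_scalar_mx -scalemxAl.
  by rewrite rmorphB rmorph1; exact: convex_combinationB.
have iterE k : relaxed_multisplitting M N E omega b x0 k - xs
    = iter k (mulmx (omega%:C *: T + ((1 - omega)%:C)%:M)) (x0 - xs).
  by elim: k => // k IHk; rewrite [RHS]iterS -IHk -stepE.
apply: cvg_mx_normc => i.
under eq_fun => k.
  have -> : relaxed_multisplitting M N E omega b x0 k i 0 - xs i 0
      = (relaxed_multisplitting M N E omega b x0 k - xs) i 0 by rewrite !mxE.
  rewrite iterE; over.
apply: cvg0_iter_eigenvalue_lt1 => a; apply: relaxed_eigenvalue_lt1 w2.
have /choice[beta EE] : forall k, exists beta : R, E k = (beta%:C)%:M.
  by case: cases => -[].
(* The index [i] guarantees a diagonal entry from which the weights are read; in dimension 0, [E]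
   would not determine them. *)
have b0 k : 0 <= beta k.
  by have [_ /(_ i i)] := E0 k; rewrite EE mxE eqxx mulr1n lecR.
have b1 : \sum_k beta k = 1.
  apply: (@complexI R); rewrite rmorph_sum [RHS]rmorph1 /=.
  have /matrixP/(_ i i) := E1; rewrite summxE mxE eqxx mulr1n => <-.
  by apply: eq_bigr => k _; rewrite EE mxE eqxx mulr1n.
have TE : T = \sum_k (beta k)%:C *: (invmx (M k) *m N k).
  by apply: eq_bigr => k _; rewrite EE -mulmxA mul_scalar_mx.
move=> c; rewrite TE; case: cases => -[_ MN].
  (* The common norm is [|A v|] in case (i) and [|v|] in case (ii). *)
  apply: (eigenvalue_convex_contraction (S := A)) => // k v.
  by have [AE uM] := AMN k; apply: splitting_contraction => //; case: (MN k).
apply: (eigenvalue_convex_contraction (S := 1%:M)) => // k v v0.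
by rewrite !mul1mx; exact: sqnorm2_mulmx_lt.
Qed.
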